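(* If $\ell\ge 2$ is an integer and $0<r<1$, then $$N(\ell,r)\le 2\pi\cdot 308^{\ell-2}\, r^{-5(\ell-2)-1},$$ where $N(\ell,r)$ is the maximum number of jumps in a sequence of foldings, as defined in the context.
   Context: Foldings: for a unit vector $h\in\mathbb{R}^d$, let $H=\{v\in\mathbb{R}^d:\langle v,h\rangle\ge 0\}$ be the corresponding closed half-space (so $0\in\partial H$). The folding $\mathcal{F}_H:\mathbb{R}^d\to\mathbb{R}^d$ relative to $H$ is $\mathcal{F}_H(v)=v$ if $v\in H$, and $\mathcal{F}_H(v)=v-2\langle v,h\rangle h$ if $v\notin H$. $\mathcal{B}(x,r)$ denotes the closed ball with center $x$ and radius $r$ in $\mathbb{R}^d$. Definition of $N(\ell,r)$: let $\ell\ge 1$ be an integer and $0<r<1$. Consider all choices of: an integer $d\ge 2$; closed half-spaces $H_1,\dots,H_\ell$ in $\mathbb{R}^d$ (each of the form $H_k=\{v\in\mathbb{R}^d:\langle v,h_k\rangle\ge 0\}$ for some unit vector $h_k\in\mathbb{R}^d$); points $v_1,w_0\in\mathbb{R}^d$ such that $\mathcal{B}(w_0,r)\subset\bigcap_{k=1}^\ell H_k$ and $|w_0-v_1|\le 1$; and a sequence of integers $\{\alpha_j\}_{j\ge 1}$ with $1\le\alpha_j\le\ell$ for all $j$. For such data let $v_{k+1}=\mathcal{F}_{H_{\alpha_k}}(v_k)$ for $k\ge 1$. A jump occurs at time $k$ if $v_{k+1}\ne v_k$. Then $N(\ell,r)$ is the maximum (a priori, the supremum in $\{0,1,2,\dots\}\cup\{\infty\}$),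 over all such data (including all $d\ge 2$), of the number of jumps in the sequence $\{v_k\}_{k\ge 1}$. *)

(* Defs.v *)
From mathcomp Require Import all_boot all_order all_algebra.
From mathcomp Require Import all_classical all_reals all_analysis.

Set Implicit Arguments.
Unset Strict Implicit.
Unset Printing Implicit Defensive.

Import Order.TTheory GRing.Theory Num.Theory.

Local Open Scope classical_set_scope.
Local Open Scope ring_scope.

Definition dotp (R : realType) (d : nat) (u v : 'rV[R]_d) : R :=
  \sum_(i < d) u 0 i * v 0 i.

(* The norm that the library puts on 'rV[R]_d is the sup norm, hence this
   Euclidean norm and the closed balls [eball] for it. *)
Definition enorm (R : realType) (d : nat) (v : 'rV[R]_d) : R :=
  Num.sqrt (dotp v v).

Definition eball (R : realType) (d : nat) (c : 'rV[R]_d) (r : R) :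
    set 'rV[R]_d :=
  [set v | enorm (v - c) <= r].

Definition halfspace (R : realType) (d : nat) (h : 'rV[R]_d) :
    set 'rV[R]_d :=
  [set v | 0 <= dotp v h].

Definition folding (R : realType) (d : nat) (h v : 'rV[R]_d) : 'rV[R]_d :=
  if v \in halfspace h then v else v - (2 * dotp v h) *: h.

(* Times are counted from 0: [fold_seq h alpha v1 k] is v_(k+1) and [alpha k]
   is alpha_(k+1); the half-spaces are indexed by 'I_l, i.e. by 0, ..., l-1. *)
Fixpoint fold_seq (R : realType) (d l : nat) (h : 'I_l -> 'rV[R]_d)
    (alpha : nat -> 'I_l) (v1 : 'rV[R]_d) (k : nat) : 'rV[R]_d :=
  if k is j.+1 then folding (h (alpha j)) (fold_seq h alpha v1 j) else v1.

Definition jump_times (R : realType) (d : nat) (v : nat -> 'rV[R]_d) :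
    set nat :=
  [set k | v k.+1 <> v k].

Definition jump_counts (R : realType) (l : nat) (r : R) : set (\bar R) :=
  [set n | exists (d : nat) (h : 'I_l -> 'rV[R]_d) (v1 w0 : 'rV[R]_d)
             (alpha : nat -> 'I_l),
      [/\ (2 <= d)%N,
          forall i, enorm (h i) = 1,
          eball w0 r `<=` \bigcap_(i in [set: 'I_l]) halfspace (h i),
          enorm (w0 - v1) <= 1
        & n = counting (jump_times (fold_seq h alpha v1))]].

(* The supremum is taken in \bar R; all the counts are natural numbers or +oo. *)
Definition max_jumps (R : realType) (l : nat) (r : R) : \bar R :=
  ereal_sup (jump_counts l r).

(* Main.v *)
Require Import Defs.
From mathcomp Require Import all_boot all_order all_algebra finmap.
From mathcomp Require Import all_classical all_reals all_analysis.
From mathcomp Require Import ring lra.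

Import Order.TTheory GRing.Theory Num.Theory.
Import numFieldNormedType.Exports.

Set Implicit Arguments.
Unset Strict Implicit.
Unset Printing Implicit Defensive.

Local Open Scope ring_scope.

(** Why the theorem is true.

    Only the jumps matter, so a trajectory is described by the word s of the
    indices of its successive jumps.  Let v be its first point, e its last one
    and L the sum of the lengths of its jumps.  Reflections are isometries
    fixing 0, so |e| = |v|.  Let q = r^2 / 2, and let w0 be the centre of the
    ball, which has distance at least r to every hyperplane.

    A jump over the hyperplane of h_i brings the trajectory closer to every
    point w with <w, h_i> >= 0, and the squared distance decreases by twice
    the length of the jump times <w, h_i> ([energy]).  Two facts follow.

    (1) If an initial part of length D uses every index of the whole word, then
    q L <= D ([block_length]).  Indeed v is then within D of every half-space
    in play, so that moving v by a proportion of order D / r towards w0 gives a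
    point w at depth D in all of them; since |v - w| is of order D / r, the
    energy inequality for w bounds 2 D L by a multiple of D^2 / r^2.

    (2) Some index i of the word satisfies <e, h_i> >= q L ([far_halfspace]).
    Indeed the energy inequality for w0 gives r L <= |v - e|, while
    |v - e|^2 = 2 <e - v, e> is at most 2 L times the largest <e, h_i>, because
    e - v is the sum of the jumps.

    Now suppose that m half-spaces allow at most J jumps, and consider m + 1
    half-spaces.  Any J + 1 consecutive jumps use all the indices, so by
    (1) they multiply the remaining length by at most 1 - q.  After M such
    blocks, where (1 - q)^M <= q, the remaining length is at most q L.  From
    then on the index i of (2) cannot occur: at a jump over its hyperplane the
    trajectory has <., h_i> < 0 and is farther than the remaining length from
    e.  Hence at most J further jumps happen, and the total is at most
    M (J + 1) + J ([jumps_le_step]).  As M is of order r^-4, passing from m to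
    m + 1 half-spaces costs at most a factor 308 r^-5 ([jumps_le_stepR]).

    For two half-spaces the jumps alternate, and the depths x_1, x_2, ... of
    the points that jump satisfy x_(k+1) + x_(k-1) = kappa x_k with
    kappa = - 2 <h_1, h_2>.  If |h_1 + h_2| <= r, the depths decrease by at
    least r at each jump and x_1 <= 1 - r ([steep]).  Otherwise kappa is twice
    the cosine of an angle psi > r, and a solution of the recurrence cannot
    stay positive for longer than a half-turn, that is for about pi / psi
    steps ([rec2_pos_le]).  Both cases give at most 2 pi / r jumps. *)

(** * Positive solutions of a linear recurrence *)

Lemma bernoulli_inv (R : realType) (q : R) n :
  0 <= q <= 1 -> (1 - q) ^+ n * (1 + n%:R * q) <= 1.
Proof.
case/andP=> q0 q1; elim: n => [|n IH]; first by rewrite mul0r addr0 mulr1.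
apply: le_trans IH; rewrite exprSr -mulrA ler_wpM2l //.
  by rewrite exprn_ge0 // subr_ge0.
have : 0 <= n%:R * q * q by rewrite !mulr_ge0.
rewrite -natr1; have := mulr_ge0 q0 q0; move: (n%:R) => a; lra.
Qed.

Section PlaneRecurrence.
Variable R : realType.
Implicit Types (kappa psi p q r x : R).

Lemma sin_le_id x : 0 <= x -> sin x <= x.
Proof.
move=> x0.
have sin_cont : {within `[0, x], continuous (@sin R)}%classic.
  by apply: continuous_subspaceT => y; apply: continuous_sin.
have [c _] := MVT_segment x0 (fun y _ => is_derive_sin y) sin_cont.
by rewrite sin0 !subr0 => ->; rewrite ler_piMl // cos_le1.
Qed.

(** The sequence with first terms [p], [q] and
    [x_(k+2) = kappa * x_(k+1) - x_k].  Recursion shifts the two initial values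
    instead of appending terms: this is how the depths of a trajectory change
    when its first jump is removed. *)
Fixpoint rec2 kappa p q k : R :=
  if k is k'.+1 then rec2 kappa q (kappa * q - p) k' else p.

Lemma rec2_sin psi p q k :
  rec2 (2 * cos psi) p q k.+1 * sin psi =
    q * sin (k.+1%:R * psi) - p * sin (k%:R * psi).
Proof.
elim: k p q => [|k IH] p q.
  by rewrite /= mul1r mul0r sin0 mulr0 subr0.
rewrite -[LHS]/(rec2 _ q (2 * cos psi * q - p) k.+1 * _) IH.
set th := k.+1%:R * psi.
have -> : k.+2%:R * psi = th + psi by rewrite -natr1 mulrDl mul1r.
have -> : k%:R * psi = th - psi by rewrite /th -natr1 mulrDl mul1r addrK.
by rewrite sinB sinD; ring.
Qed.

(** A discrete Sturm comparison: for [kappa = 2 cos psi] the closed form of the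
    sequence is a combination of two consecutive sines, which have opposite
    signs around the multiple of [psi] that passes [pi].  The hypothesis on
    [kappa] says [r < 2 sin (psi / 2)], hence [r < psi]. *)
Lemma rec2_pos_le kappa p q r n : 0 < r -> r < 1 -> r ^+ 2 < 2 - kappa ->
  (forall k, (0 < k <= n)%N -> 0 < rec2 kappa p q k) ->
  n%:R <= 2 * pi / r.
Proof.
move=> r0 r1 rk pos.
have pir : 2 * pi = pi + pi :> R by rewrite mulrDl !mul1r.
have pi1 : 1 <= pi / r.
  rewrite ler_pdivlMr // mul1r ltW // (lt_le_trans r1) //.
  by apply: le_trans (pi_ge2 R); rewrite ler1n.
rewrite pir mulrDl.
(* Three positive terms force kappa > 0, so that psi lies in ]0, pi[ below. *)
have [n2|n3] := leqP n 2.
  by rewrite (le_trans _ (lerD pi1 pi1)) // -(natrD _ 1 1) ler_nat.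
have q0 : 0 < q by apply: (pos 1%N); rewrite (leq_trans _ n3).
have x20 : 0 < kappa * q - p by apply: (pos 2); rewrite (leq_trans _ n3).
have x30 : 0 < kappa * (kappa * q - p) - q by apply: (pos 3).
have k0 : 0 < kappa.
  by rewrite -(pmulr_lgt0 _ x20) (lt_trans q0) // -subr_gt0.
have r20 : 0 < r ^+ 2 by rewrite exprn_gt0.
have k2 : -1 <= kappa / 2 <= 1 by apply/andP; split; lra.
set psi := acos (kappa / 2).
have cospsi : cos psi = kappa / 2 by rewrite acosK // in_itv.
have psi0 : 0 < psi by apply: acos_gt0; apply/andP; split; lra.
have psipi : psi < pi by apply: acos_ltpi; apply/andP; split; lra.
have sin0 : 0 < sin psi by apply: sin_gt0_pi; rewrite psi0.
have kE : kappa = 2 * cos psi by rewrite cospsi; lra.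
have rpsi : r < psi.
  rewrite -(@ltr_pXn2r _ 2) // ?nnegrE ?ltW // (lt_le_trans rk) //.
  have h0 : 0 <= psi / 2 by rewrite divr_ge0 // ltW.
  have hpi : psi / 2 <= pi by lra.
  have s0 : 0 <= sin (psi / 2) by apply: sin_ge0_pi; rewrite h0.
  have : sin (psi / 2) ^+ 2 <= (psi / 2) ^+ 2.
    by rewrite ler_pXn2r // sin_le_id.
  have : cos psi = 1 - 2 * sin (psi / 2) ^+ 2.
    have halves : psi = psi / 2 + psi / 2 by lra.
    by rewrite {1}halves cosD -!expr2; have := cos2Dsin2 (psi / 2); lra.
  rewrite kE; lra.
have pp0 : 0 <= pi / psi by rewrite divr_ge0 ?pi_ge0 // ltW.
have /andP[K1 K2] := truncn_itv pp0; set K := Num.truncn _ in K1 K2.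
rewrite ler_pdivlMr // in K1; rewrite ltr_pdivrMr // in K2.
(* The recurrence is started at x_1, x_2: both are known to be positive. *)
have nK : (n <= K.+1)%N.
  rewrite leqNgt; apply/negP => Kn.
  have xK : 0 < rec2 (2 * cos psi) q (2 * cos psi * q - p) K.+1.
    by rewrite -kE; apply: (pos K.+2).
  have := mulr_gt0 xK sin0; rewrite rec2_sin ltNge => /negP; apply.
  rewrite subr_le0 (@le_trans _ _ 0) //.
    rewrite -(subrK pi (_ * psi)) sinDpi mulrN oppr_le0 mulr_ge0 //.
      by rewrite -kE ltW.
    apply: sin_ge0_pi; apply/andP; split; first by lra.
    by rewrite -natr1 mulrDl; lra.
  rewrite mulr_ge0 ?(ltW q0) //; apply: sin_ge0_pi.
  by rewrite K1 mulr_ge0 // ltW.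
rewrite -lerBlDr (@le_trans _ _ K%:R) //.
  by rewrite (@le_trans _ _ (n%:R - 1)) ?lerB // lerBlDr natr1 ler_nat.
by rewrite ler_pdivlMr // (le_trans _ K1) // ler_wpM2l // ltW.
Qed.

End PlaneRecurrence.

(** * The Euclidean dot product *)

Section DotProduct.
Variables (R : realType) (d : nat).
Implicit Types (u v w h : 'rV[R]_d) (a : R).

Lemma dotpC u v : dotp u v = dotp v u.
Proof. by apply: eq_bigr => i _; rewrite mulrC. Qed.

Lemma dotpDl u v w : dotp (u + v) w = dotp u w + dotp v w.
Proof. by rewrite -big_split; apply: eq_bigr => i _; rewrite mxE mulrDl. Qed.

Lemma dotpZl a u v : dotp (a *: u) v = a * dotp u v.
Proof. by rewrite mulr_sumr; apply: eq_bigr => i _; rewrite mxE mulrA. Qed.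

Lemma dotpNl u v : dotp (- u) v = - dotp u v.
Proof. by rewrite -scaleN1r dotpZl mulN1r. Qed.

Lemma dotpDr u v w : dotp u (v + w) = dotp u v + dotp u w.
Proof. by rewrite dotpC dotpDl !(dotpC u). Qed.

Lemma dotpZr a u v : dotp u (a *: v) = a * dotp u v.
Proof. by rewrite dotpC dotpZl dotpC. Qed.

Lemma dotpNr u v : dotp u (- v) = - dotp u v.
Proof. by rewrite dotpC dotpNl dotpC. Qed.

Definition dotpE := (dotpDl, dotpDr, dotpNl, dotpNr, dotpZl, dotpZr).

Lemma dotp_ge0 u : 0 <= dotp u u.
Proof. by apply: sumr_ge0 => i _; rewrite -expr2 sqr_ge0. Qed.

Lemma dotp_eq0 u : dotp u u = 0 -> u = 0.
Proof.
move/eqP; rewrite psumr_eq0 => [/allP uu0|i _]; last by rewrite -expr2 sqr_ge0.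
apply/rowP => i; rewrite mxE; apply/eqP.
by have := uu0 i (mem_index_enum i); rewrite /= -expr2 sqrf_eq0.
Qed.

Lemma cauchy_schwarz u v : dotp u v ^+ 2 <= dotp u u * dotp v v.
Proof.
have [/dotp_eq0 ->|vn0] := eqVneq (dotp v v) 0.
  rewrite -(scale0r (0 : 'rV[R]_d)) !dotpE !mul0r expr0n /=.
  by rewrite mulr0.
have v_gt0 : 0 < dotp v v by rewrite lt_neqAle eq_sym vn0 dotp_ge0.
rewrite -(ler_pM2r v_gt0) -subr_ge0.
have := dotp_ge0 (dotp v v *: u - dotp u v *: v).
by rewrite !dotpE (dotpC v u); congr (0 <= _); ring.
Qed.

Definition reflect_in h v := v - (2 * dotp v h) *: h.

Lemma enorm1 h : enorm h = 1 -> dotp h h = 1.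
Proof.
by move=> h1; rewrite -(sqr_sqrtr (dotp_ge0 h)) -/(enorm h) h1 expr1n.
Qed.

Lemma ball_in_halfspace h w r : 0 <= r -> enorm h = 1 ->
  (eball w r `<=` halfspace h)%classic -> r <= dotp w h.
Proof.
move=> r0 h1 sub.
have : halfspace h (w - r *: h).
  apply: sub; rewrite /eball /= addrC addKr /enorm.
  have -> : dotp (- (r *: h)) (- (r *: h)) = r ^+ 2.
    by rewrite !dotpE (enorm1 h1); ring.
  by rewrite sqrtr_sqr ger0_norm.
by rewrite /halfspace /= !dotpE (enorm1 h1) mulr1 subr_ge0.
Qed.

End DotProduct.

(** * Words of jumps *)

Section Words.
Variables (R : realType) (d : nat) (I : finType) (h : I -> 'rV[R]_d).
Hypothesis h_unit : forall i, dotp (h i) (h i) = 1.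
Implicit Types (v w g : 'rV[R]_d) (s : seq I).

Fixpoint all_jumps v s :=
  if s is i :: s' then (dotp v (h i) < 0) && all_jumps (reflect_in (h i) v) s'
  else true.

Fixpoint endpoint v s :=
  if s is i :: s' then endpoint (reflect_in (h i) v) s' else v.

Fixpoint path_length v s : R :=
  if s is i :: s' then - 2 * dotp v (h i) + path_length (reflect_in (h i) v) s'
  else 0.

Lemma all_jumps_cat v s t :
  all_jumps v (s ++ t) = all_jumps v s && all_jumps (endpoint v s) t.
Proof. by elim: s v => //= i s IH v; rewrite IH andbA. Qed.

Lemma endpoint_cat v s t : endpoint v (s ++ t) = endpoint (endpoint v s) t.
Proof. by elim: s v => //= i s IH v; rewrite IH. Qed.

Lemma path_length_cat v s t :
  path_length v (s ++ t) = path_length v s + path_length (endpoint v s) t.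
Proof. by elim: s v => [v|i s IH v] /=; rewrite ?add0r // IH addrA. Qed.

Lemma path_length_ge0 v s : all_jumps v s -> 0 <= path_length v s.
Proof.
elim: s v => //= i s IH v /andP[vi /IH]; move: (path_length _ _) => l; lra.
Qed.

Lemma path_length_gt0 v s : s != [::] -> all_jumps v s -> 0 < path_length v s.
Proof.
case: s => //= i s _ /andP[vi /path_length_ge0]; move: (path_length _ _) => l.
lra.
Qed.

Lemma reflect_in_self v i : dotp (reflect_in (h i) v) (h i) = - dotp v (h i).
Proof. by rewrite /reflect_in !dotpE h_unit; ring. Qed.

Lemma endpoint_norm v s :
  dotp (endpoint v s) (endpoint v s) = dotp v v.
Proof.
elim: s v => //= i s IH v; rewrite IH /reflect_in !dotpE h_unit (dotpC (h i) v).
ring.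
Qed.

(** A reflection preserves the norm, so a jump from [v] to
    [v - 2 <v, h> h] changes the squared distance to [w] by
    [4 <v, h> <w, h>], and [- 2 <v, h>] is the length of that jump. *)
Lemma energy w c v s : {in s, forall i, c <= dotp w (h i)} -> all_jumps v s ->
  2 * c * path_length v s + dotp (endpoint v s - w) (endpoint v s - w)
    <= dotp (v - w) (v - w).
Proof.
elim: s v => [v _ _|i s IH v cw] /=; first by rewrite mulr0 add0r.
case/andP=> vi js.
have {}IH := IH _ (fun j j_s => cw j (@mem_behead _ (i :: s) j j_s)) js.
have cwi := cw i (mem_head i s).
rewrite mulrDr -addrA (le_trans (lerD (lexx _) IH)) //.
rewrite /reflect_in !dotpE h_unit (dotpC (h i) v) (dotpC (h i) w) (dotpC w v).
set a := dotp v (h i) in vi *; set b := dotp w (h i) in cwi *.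
have : 0 <= - a * (b - c) by rewrite mulr_ge0 ?oppr_ge0 ?subr_ge0 // ltW.
set vv := dotp v v; set vw := dotp v w; set ww := dotp w w.
lra.
Qed.

Lemma unit_dotp_abs u g : dotp u u <= 1 -> dotp g g <= 1 -> `|dotp u g| <= 1.
Proof.
move=> u1 g1; rewrite -(@ler_pXn2r _ 2) ?nnegrE // expr1n.
rewrite real_normK ?num_real //.
apply: le_trans (cauchy_schwarz u g) _.
by rewrite -[leRHS]mulr1 ler_pM ?dotp_ge0.
Qed.

Lemma drift v s g : dotp g g = 1 -> all_jumps v s ->
  `|dotp (endpoint v s) g - dotp v g| <= path_length v s.
Proof.
move=> g1; elim: s v => [v _|i s IH v] /=; first by rewrite subrr normr0.
case/andP=> vi /IH {}IH.
have ig : `|dotp (h i) g| <= 1 by apply: unit_dotp_abs; rewrite ?h_unit ?g1.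
rewrite (le_trans (ler_distD (dotp (reflect_in (h i) v) g) _ _)) //.
rewrite addrC lerD //.
have -> : dotp (reflect_in (h i) v) g - dotp v g =
    - 2 * dotp v (h i) * dotp (h i) g by rewrite /reflect_in !dotpE; ring.
have vi0 : 0 <= - 2 * dotp v (h i) by lra.
by rewrite normrM (ger0_norm vi0) ler_piMr.
Qed.

(** [endpoint v s - v] is the sum of the jumps, each a positive multiple of
    some [h i]. *)
Lemma advance_lt v s g c : s != [::] -> {in s, forall i, dotp (h i) g < c} ->
  all_jumps v s -> dotp (endpoint v s - v) g < c * path_length v s.
Proof.
elim: s v => // i s IH v _ cg /= /andP[vi js].
have cgi := cg i (mem_head i s).
have step : dotp (reflect_in (h i) v - v) g < c * (- 2 * dotp v (h i)).
  rewrite /reflect_in addrC addKr !dotpE.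
  move: (dotp v _) (dotp _ g) vi cgi => a b a0 bc.
  have : 0 < - a * (c - b) by rewrite mulr_gt0 ?oppr_gt0 ?subr_gt0.
  lra.
have [->|sn] := eqVneq s [::]; first by rewrite /= addr0.
have := IH _ sn (fun j j_s => cg j (@mem_behead _ (i :: s) j j_s)) js.
rewrite mulrDr; move: step; rewrite !dotpE; lra.
Qed.

(** Right after its jump over the hyperplane of [h i] the trajectory is inside
    the half-space, and it has not moved farther than its length. *)
Lemma mem_path_ge v s i : all_jumps v s -> i \in s ->
  - path_length v s <= dotp v (h i).
Proof.
move=> js si; case/splitPr: s / si js => s1 s2.
rewrite -cat1s catA all_jumps_cat path_length_cat => /andP[j1 j2].
have := drift (h_unit i) j1; have := path_length_ge0 j2.
move: j1; rewrite all_jumps_cat endpoint_cat /= andbT => /andP[_ ei].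
rewrite reflect_in_self ler_norml => l2 /andP[_ dr].
lra.
Qed.

(** Just before its jump over the hyperplane of [h i] the trajectory is outside
    the half-space. *)
Lemma mem_endpoint_lt v s i : all_jumps v s -> i \in s ->
  dotp (endpoint v s) (h i) < path_length v s.
Proof.
move=> js si; case/splitPr: s / si js => s1 s2.
rewrite all_jumps_cat path_length_cat endpoint_cat => /andP[j1 j2].
have := drift (h_unit i) j2; have := path_length_ge0 j1.
have /andP[neg _] := j2; rewrite ler_norml => l1 /andP[_ dr].
lra.
Qed.

(** * The two length estimates *)

Section Margin.
Variables (r : R) (w0 : 'rV[R]_d).
Hypotheses (r_gt0 : 0 < r) (r_lt1 : r < 1).
Hypothesis w0_margin : forall i, r <= dotp w0 (h i).

Definition near_w0 v := dotp (v - w0) (v - w0) <= 1.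

Lemma near_w0_endpoint v s :
  near_w0 v -> all_jumps v s -> near_w0 (endpoint v s).
Proof.
move=> nv js; apply: le_trans nv.
apply: le_trans (energy (fun i _ => w0_margin i) js).
by rewrite lerDr mulr_ge0 ?path_length_ge0 // mulr_ge0 // ltW.
Qed.

(** The length [D] of the first part bounds the distance from [v] to every
    half-space in play, so a point [w] of the segment from [v] to [w0], close
    to [v] when [D] is small, lies at depth [D] inside all of them; [energy]
    is then applied to [w]. *)
Lemma block_length v s t : near_w0 v -> all_jumps v (s ++ t) ->
  {subset t <= s} ->
  r ^+ 2 / 2 * path_length v (s ++ t) <= path_length v s.
Proof.
move=> nv jst ts.
have /andP[js jt] : all_jumps v s && all_jumps (endpoint v s) t.
  by rewrite -all_jumps_cat.
have [s0|sn] := eqVneq s [::].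
  suff -> : t = [::] by rewrite s0 /= mulr0.
  by case: (t) ts => // i t' /(_ i (mem_head _ _)); rewrite s0.
set D := path_length v s; set L := path_length v (s ++ t).
have D0 : 0 < D by apply: path_length_gt0.
have L0 : 0 <= L by apply: path_length_ge0.
have near_all : {in s ++ t, forall i, - D <= dotp v (h i)}.
  by move=> i; rewrite mem_cat => /orP[|/ts]; apply: mem_path_ge.
(* When r < D the point w0 itself is good enough. *)
have [rD|Dr] := ltP r D.
  have := energy (fun i _ => w0_margin i) jst.
  have := dotp_ge0 (endpoint v (s ++ t) - w0); rewrite -/L => e0 en.
  have {en e0} rL : 2 * r * L <= 1.
    by apply: le_trans nv; apply: le_trans en; rewrite lerDl.
  have := ler_wpM2l (ltW r_gt0) rL; have := r_gt0; lra.
(* At the proportion D / (r + D) of the segment the depth is at least 0, hence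
   at twice this proportion it is at least D. *)
set u := 2 * D / (r + D).
have rD0 : 0 < r + D by rewrite addr_gt0.
have uE : u * (r + D) = 2 * D by rewrite /u divfK // gt_eqF.
have u0 : 0 <= u by rewrite /u divr_ge0 ?ltW // mulr_gt0.
have u1 : u <= 1 by rewrite /u ler_pdivrMr // mul1r; lra.
have wD : {in s ++ t, forall i, D <= dotp ((1 - u) *: v + u *: w0) (h i)}.
  move=> i /near_all vi; rewrite !dotpE.
  have := w0_margin i; move: (dotp v _) (dotp w0 _) vi => a b aD br.
  have : 0 <= (1 - u) * (a + D) by apply: mulr_ge0; lra.
  have : 0 <= u * (b - r) by apply: mulr_ge0; lra.
  lra.
have := energy wD jst.
have := dotp_ge0 (endpoint v (s ++ t) - ((1 - u) *: v + u *: w0)).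
move: (dotp (endpoint _ _ - _) _) => E0.
have -> : v - ((1 - u) *: v + u *: w0) = u *: (v - w0).
  by rewrite opprD scalerBl scale1r opprB addrCA addrA subrK scalerBr.
rewrite !dotpZl dotpZr -/L mulrA => E00 en.
have {}en : 2 * D * L <= u ^+ 2.
  apply: le_trans (_ : u * u * 1 <= _); last by rewrite mulr1 expr2.
  apply: le_trans (ler_wpM2l (mulr_ge0 u0 u0) nv).
  by apply: le_trans en; rewrite lerDl.
have ur : u * r <= 2 * D by rewrite -uE ler_wpM2l // lerDl ltW.
have ur2 : (u * r) ^+ 2 <= (2 * D) ^+ 2.
  by rewrite ler_pXn2r // nnegrE mulr_ge0 // ltW.
have rr : 0 <= r ^+ 2 by apply: sqr_ge0.
have : r ^+ 2 * (2 * D * L) <= (2 * D) ^+ 2.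
  by apply: le_trans ur2; rewrite exprMn mulrC ler_wpM2r.
move=> ?; rewrite -(@ler_pM2r _ (4 * D)) ?mulr_gt0 //; lra.
Qed.

(** If [e = endpoint v s] were deep inside none of the half-spaces used, then
    [|v - e|^2 = 2 <e - v, e>] would be too small for the energy spent, because
    [e - v] is a sum of jumps along their normals. *)
Lemma far_halfspace v s : near_w0 v -> all_jumps v s -> s != [::] ->
  exists2 i, i \in s
    & r ^+ 2 / 2 * path_length v s <= dotp (endpoint v s) (h i).
Proof.
move=> nv js sn; set L := path_length v s; set e := endpoint v s.
have [/hasP[i si iL]|/hasPn noti] :=
  boolP (has (fun i => r ^+ 2 / 2 * L <= dotp e (h i)) s); first by exists i.
exfalso.
have L0 : 0 < L by apply: path_length_gt0.
have lt_all : {in s, forall i, dotp (h i) e < r ^+ 2 / 2 * L}.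
  by move=> i /noti; rewrite dotpC -ltNge.
have lt_dist := advance_lt sn lt_all js; rewrite -/L -/e in lt_dist.
have distE : dotp (v - e) (v - e) = 2 * dotp (e - v) e.
  rewrite !dotpE (dotpC v e) (endpoint_norm v s : dotp e e = dotp v v); ring.
have := energy (fun i _ => w0_margin i) js; rewrite -/L -/e => en.
(* Energy gives 2 r L <= |v - w0|^2 - |e - w0|^2, whose right-hand side equals
   2 <v - e, v - w0> - |v - e|^2. *)
have rL : r * L <= dotp (v - e) (v - w0).
  have : dotp (e - w0) (e - w0) = dotp (v - w0) (v - w0)
    - 2 * dotp (v - e) (v - w0) + dotp (v - e) (v - e).
    by rewrite !dotpE (dotpC w0 v) (dotpC w0 e) (dotpC e v); ring.
  have := dotp_ge0 (v - e); move: en; rewrite -mulrA.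
  move: (dotp (v - e) (v - w0)) (dotp (v - w0) _) (dotp (e - w0) _).
  move: (dotp (v - e) (v - e)).
  move: (r * L) => *; lra.
have : (r * L) ^+ 2 <= dotp (v - e) (v - e).
  apply: le_trans (_ : dotp (v - e) (v - w0) ^+ 2 <= _).
    rewrite ler_pXn2r // nnegrE; first by rewrite mulr_ge0 // ltW.
    by apply: le_trans rL; rewrite mulr_ge0 // ltW.
  apply: le_trans (cauchy_schwarz _ _) _.
  by rewrite -[leRHS]mulr1 ler_wpM2l ?dotp_ge0.
rewrite distE; lra.
Qed.

(** * Induction on the number of half-spaces *)

Definition jumps_le (m J : nat) := forall (S : {set I}) v s,
  #|S| = m -> {subset s <= S} -> near_w0 v -> all_jumps v s -> (size s <= J)%N.

(** Each block of [J.+1] jumps uses all the indices of [S], since [m] of them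
    allow only [J] jumps; [block_length] then applies to this block. *)
Lemma path_length_decay m J (S : {set I}) M v s :
  jumps_le m J -> #|S| = m.+1 -> {subset s <= S} -> near_w0 v ->
  all_jumps v s -> (M * J.+1 <= size s)%N ->
  path_length (endpoint v (take (M * J.+1) s)) (drop (M * J.+1) s)
    <= (1 - r ^+ 2 / 2) ^+ M * path_length v s.
Proof.
move=> bJ cS; elim: M v s => [|M IH] v s sS nv js Ms.
  by rewrite mul0n take0 drop0 expr0 mul1r.
set a := take J.+1 s; set b := drop J.+1 s.
have sab : s = a ++ b by rewrite cat_take_drop.
have sa : size a = J.+1.
  by rewrite size_takel // (leq_trans _ Ms) // mulSn leq_addr.
have /andP[ja jb] : all_jumps v a && all_jumps (endpoint v a) b.
  by rewrite -all_jumps_cat -sab.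
have aS : {subset a <= S} by move=> i /mem_take /sS.
have bS : {subset b <= S} by move=> i /mem_drop /sS.
have Sa : {subset S <= a}.
  move=> i Si; apply: contraT => ia.
  have : (size a <= J)%N.
    apply: (bJ (S :\ i)%SET v) => //.
      by move: cS; rewrite (cardsD1 i) Si; case.
    move=> j ja'; rewrite !inE aS // andbT.
    by apply: contraNneq ia => <-.
  by rewrite sa ltnn.
have Mb : (M * J.+1 <= size b)%N.
  by rewrite size_drop leq_subRL ?(leq_trans _ Ms) // mulSn ?leq_addr.
have := IH _ b bS (near_w0_endpoint nv ja) jb Mb.
rewrite mulSn takeD endpoint_cat -/a -/b drop_drop addnC.
move=> /le_trans; apply.
rewrite (exprSr _ M) -mulrA ler_wpM2l //.
  by apply: exprn_ge0; have := r_gt0; have := r_lt1; nra.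
have := block_length nv (_ : all_jumps v (a ++ b)).
rewrite -sab => /(_ js (fun i ib => Sa i (bS i ib))).
have -> : path_length v s = path_length v a + path_length (endpoint v a) b.
  by rewrite -path_length_cat -sab.
lra.
Qed.

(** After [M] blocks the remaining length is at most [q] times the initial one,
    [q = r ^+ 2 / 2].  The endpoint is at depth at least [q] times the initial
    length in the half-space given by [far_halfspace], so the trajectory is
    never again outside that half-space when it jumps. *)
Lemma jumps_le_step m J M : (1 - r ^+ 2 / 2) ^+ M <= r ^+ 2 / 2 ->
  jumps_le m J -> jumps_le m.+1 (M * J.+1 + J).
Proof.
move=> Mq bJ S v s cS sS nv js.
have [Ms|] := leqP (M * J.+1) (size s); last first.
  by move=> /ltnW /leq_trans; apply; rewrite leq_addr.
have [s0|sn] := eqVneq s [::]; first by rewrite s0.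
have decay := path_length_decay bJ cS sS nv js Ms.
set a := take _ s in decay; set b := drop _ s in decay.
have sab : s = a ++ b by rewrite cat_take_drop.
have sa : size a = (M * J.+1)%N by rewrite size_takel.
have /andP[ja jb] : all_jumps v a && all_jumps (endpoint v a) b.
  by rewrite -all_jumps_cat -sab.
have [i si far] := far_halfspace nv js sn.
have ib : i \notin b.
  apply/negP => ib.
  have eb := mem_endpoint_lt jb ib.
  rewrite -endpoint_cat -sab in eb.
  have := lt_le_trans (le_lt_trans far eb) decay.
  by rewrite ltNge ler_wpM2r // path_length_ge0.
have sb : (size b <= J)%N.
  apply: (bJ (S :\ i)%SET (endpoint v a)) => //.
  - by move: cS; rewrite (cardsD1 i) (sS i si); case.
  - move=> j jb'; rewrite !inE (sS j (mem_drop jb')) andbT.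
    by apply: contraNneq ib => <-.
  - exact: near_w0_endpoint.
by rewrite sab size_cat sa leq_add2l.
Qed.

(** By Bernoulli's inequality [(1 - q)^M <= 1 / (1 + M q)], which is at most [q]
    as soon as [M q^2 >= 1], that is [M >= 4 / r^4]. *)
Lemma jumps_le_stepR m J (b : R) : jumps_le m J -> J%:R <= b -> 1 <= b ->
  exists2 J', jumps_le m.+1 J' & J'%:R <= 308 * r ^- 5 * b.
Proof.
move=> bJ Jb b1.
have x1 : 1 <= r^-1 by rewrite invf_ge1 // ltW.
set x := r^-1 in x1.
have xr : x * r = 1 by rewrite mulVf // gt_eqF.
set M := (Num.truncn (4 * x ^+ 4)).+1.
have x4 : 1 <= x ^+ 4 by rewrite exprn_ege1.
have M1 : 4 * x ^+ 4 <= M%:R by rewrite ltW // truncnS_gt.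
have M2 : M%:R <= 4 * x ^+ 4 + 1.
  by rewrite /M -natr1 lerD2r truncn_le; lra.
set q := r ^+ 2 / 2.
have q0 : 0 <= q by rewrite divr_ge0 // sqr_ge0.
have q1 : q <= 1 by rewrite /q; have := r_gt0; have := r_lt1; nra.
have Mq : (1 - q) ^+ M <= q.
  have big : 1 <= (1 + M%:R * q) * q.
    have : 4 * x ^+ 4 * (q * q) <= M%:R * (q * q).
      by rewrite ler_wpM2r // mulr_ge0.
    have -> : 4 * x ^+ 4 * (q * q) = (x * r) ^+ 4 by rewrite /q; field.
    by rewrite xr expr1n; lra.
  apply: le_trans (_ : (1 - q) ^+ M * ((1 + M%:R * q) * q) <= _).
    by rewrite -[leLHS]mulr1 ler_wpM2l // exprn_ge0 // subr_ge0.
  by rewrite mulrA -[leRHS]mul1r ler_wpM2r // bernoulli_inv // q0.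
exists (M * J.+1 + J)%N; first exact: jumps_le_step.
rewrite natrD natrM -natr1.
have J0 : 0 <= J%:R :> R by [].
have -> : r ^- 5 = x ^+ 5 by rewrite exprVn.
have x5 : x ^+ 4 <= x ^+ 5.
  by rewrite (exprS x 4) ler_peMl // exprn_ge0 // (le_trans _ x1).
apply: le_trans (_ : (5 * x ^+ 5) * (b + b) + x ^+ 5 * b <= _).
  apply: lerD; last by rewrite (le_trans Jb) // ler_peMl; lra.
  by apply: ler_pM; lra.
have : 0 <= x ^+ 5 * b by rewrite mulr_ge0 //; lra.
lra.
Qed.

(** * Two half-spaces *)

(** A jump over a hyperplane is never followed by a jump over the same one. *)
Lemma swap_index v i j x s : {subset x :: s <= [set i; j]} ->
  dotp v (h i) < 0 -> all_jumps (reflect_in (h i) v) (x :: s) ->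
  x = j /\ {subset s <= [set j; i]}.
Proof.
move=> sub vi /= /andP[xneg _]; split; last first.
  by move=> y ys; rewrite finset.setUC; apply: sub; rewrite in_cons ys orbT.
have : x \in [set i; j] by apply: sub; rewrite mem_head.
rewrite !inE => /orP[] /eqP // xi.
by move: xneg; rewrite xi reflect_in_self oppr_lt0 ltNge ltW.
Qed.

(** A jump over the hyperplane of [h i] turns the pair
    [(<v, h j>, - <v, h i>)] into
    [(- <v, h i>, kappa * (- <v, h i>) - <v, h j>)], which is the same pair for
    the new point with [i] and [j] exchanged. *)
Lemma alternate v i j s : {subset s <= [set i; j]} -> all_jumps v (i :: s) ->
  forall k, (k < (size s).+1)%N ->
  0 < rec2 (- 2 * dotp (h i) (h j)) (dotp v (h j)) (- dotp v (h i)) k.+1.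
Proof.
elim: s v i j => [|x s IH] v i j sub /andP[vi js] [|k] ks //;
  try by rewrite /= oppr_gt0.
have [xj sub'] := swap_index sub vi js; rewrite xj in js.
have := IH _ j i sub' js k ks; rewrite reflect_in_self.
have -> : - dotp (reflect_in (h i) v) (h j) =
    - 2 * dotp (h i) (h j) * - dotp v (h i) - dotp v (h j).
  by rewrite /reflect_in !dotpE; ring.
by rewrite (dotpC (h j) (h i)).
Qed.

Lemma depth_le v i : near_w0 v -> - dotp v (h i) <= 1 - r.
Proof.
move=> nv; have : `|dotp (v - w0) (h i)| <= 1.
  by apply: unit_dotp_abs => //; rewrite h_unit.
have := w0_margin i; rewrite ler_norml !dotpE => + /andP[+ _]; lra.
Qed.

(** For consecutive depths [x], [x'] the point [v'] between the two jumps has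
    [<v', h i> = x] and [<v', h j> = - x'], so [x - x' = <v', h i + h j>]; this
    is at least [2 r] at [w0] and differs from its value there by at most
    [|h i + h j|]. *)
Lemma steep v i j s : dotp (h i + h j) (h i + h j) <= r ^+ 2 ->
  near_w0 v -> {subset s <= [set i; j]} -> all_jumps v (i :: s) ->
  (size s)%:R * r <= - dotp v (h i).
Proof.
elim: s v i j => [|x s IH] v i j hij nv sub /andP[vi js].
  by rewrite mul0r oppr_ge0 ltW.
have [xj sub'] := swap_index sub vi js; rewrite xj in js.
set v' := reflect_in (h i) v in js.
have nv' : near_w0 v' by apply: (@near_w0_endpoint v [:: i]); rewrite //= vi.
have vE : dotp v' (h i) = - dotp v (h i) by rewrite reflect_in_self.
clearbody v'.
have hji : dotp (h j + h i) (h j + h i) <= r ^+ 2 by rewrite addrC.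
have := IH v' j i hji nv' sub' js.
have : `|dotp (v' - w0) (h i + h j)| <= r.
  rewrite -(@ler_pXn2r _ 2) ?nnegrE ?(ltW r_gt0) // real_normK ?num_real //.
  apply: le_trans (cauchy_schwarz _ _) _.
  by rewrite -[leRHS]mul1r ler_pM ?dotp_ge0.
have := w0_margin i; have := w0_margin j.
rewrite ler_norml !dotpE vE -natr1 mulrDl mul1r.
move=> + + /andP[+ _]; lra.
Qed.

Lemma two_halfspaces : exists2 J, jumps_le 2 J & J%:R <= 2 * pi / r.
Proof.
have b0 : 0 <= 2 * pi / r.
  by rewrite divr_ge0 ?(ltW r_gt0) // mulr_ge0 // pi_ge0.
exists (Num.truncn (2 * pi / r)); last by rewrite truncn_le.
move=> S v s /eqP/cards2P[i [j [_ ->]]] sS nv js; rewrite truncn_ge_nat //.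
case: s sS js => // x s sS js.
wlog xi : i j sS / x = i.
  have : x \in [set i; j] by apply: sS; rewrite mem_head.
  rewrite !inE => /orP[] /eqP xE; first by move/(_ i j sS xE).
  by move/(_ j i); apply=> //; rewrite finset.setUC.
rewrite {}xi in sS js.
have sub : {subset s <= [set i; j]}.
  by move=> y ys; apply: sS; rewrite in_cons ys orbT.
have [hij|hij] := leP (dotp (h i + h j) (h i + h j)) (r ^+ 2).
  have := steep hij nv sub js; have := depth_le i nv => d1 d2.
  rewrite ler_pdivlMr //= -natr1 mulrDl mul1r.
  by have := pi_ge2 R; have := r_gt0; lra.
apply: (@rec2_pos_le _ (- 2 * dotp (h i) (h j))
  (dotp v (h j)) (- dotp v (h i))) => //.
  by move: hij; rewrite !dotpE !h_unit (dotpC (h j)); lra.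
by case=> // k kn; apply: (alternate sub js).
Qed.

(** * Any number of half-spaces *)

Lemma jumps_bound k : exists2 J, jumps_le k.+2 J &
  J%:R <= 2 * pi * 308 ^+ k * r ^- (5 * k + 1).
Proof.
elim: k => [|k [J bJ Jb]].
  by rewrite muln0 add0n expr0 mulr1 expr1; apply: two_halfspaces.
have x1 : 1 <= r^-1 by rewrite invf_ge1 // ltW.
have [] := jumps_le_stepR bJ Jb.
  have pi1 : 1 <= pi :> R by apply: le_trans (pi_ge2 R); rewrite ler1n.
  by rewrite -exprVn !mulr_ege1 ?exprn_ege1 // ler1n.
move=> J' bJ' J'b; exists J' => //; apply: le_trans J'b _.
suff -> : 308 * r ^- 5 * (2 * pi * 308 ^+ k * r ^- (5 * k + 1)) =
  2 * pi * 308 ^+ k.+1 * r ^- (5 * k.+1 + 1) by [].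
rewrite mulnS -addnA -!exprVn (exprD _ 5) (exprS _ k).
move: (308 ^+ k) (r^-1 ^+ (5 * k + 1)) => a c; ring.
Qed.

End Margin.
End Words.

(** * From folding sequences to words of jumps *)

Lemma foldingE (R : realType) d (h v : 'rV[R]_d) :
  folding h v = if dotp v h < 0 then reflect_in h v else v.
Proof.
rewrite /folding; have -> : (v \in halfspace h) = (0 <= dotp v h).
  by apply/idP/idP; rewrite inE.
by rewrite ltNge; case: ifP.
Qed.

Lemma counting_le (R : realType) (A : set nat) (p : pred nat) (b : R) :
  (forall k, A k -> p k) -> (forall K, (count p (iota 0 K))%:R <= b) ->
  (counting A <= b%:E)%E.
Proof.
move=> Ap cb.
have fb (B : {fset nat}) : ([set` B] `<=` A)%classic -> (#|` B|)%:R <= b.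
  move=> BA; apply: le_trans (cb (\max_(k <- B) k).+1).
  rewrite ler_nat -size_filter; apply: uniq_leq_size (fset_uniq B) _ => k kB.
  rewrite mem_filter (Ap _ (BA k kB)) mem_iota /= add0n ltnS.
  exact: (@leq_bigmax_seq _ _ xpredT id).
rewrite /counting; case: asboolP => [finA|infA].
  by rewrite lee_fin; apply: fb; rewrite fset_setK.
have [B BA nB] := infinite_set_fset (Num.truncn b).+1 infA.
have := truncnS_gt b; rewrite ltNge => /negP; case.
by apply: le_trans (fb B BA); rewrite ler_nat.
Qed.

Section FoldSequence.
Variables (R : realType) (d l : nat) (h : 'I_l -> 'rV[R]_d).
Variables (alpha : nat -> 'I_l) (v1 : 'rV[R]_d).

Definition jumps_at k := dotp (fold_seq h alpha v1 k) (h (alpha k)) < 0.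

Definition jump_word K := [seq alpha k | k <- iota 0 K & jumps_at k].

Lemma jump_wordP K : all_jumps h v1 (jump_word K) /\
  endpoint h v1 (jump_word K) = fold_seq h alpha v1 K.
Proof.
elim: K => // K [IH1 IH2]; rewrite /jump_word -addn1 iotaD filter_cat map_cat.
rewrite all_jumps_cat endpoint_cat -/(jump_word K) IH1 IH2 add0n addn1 /=.
rewrite foldingE -/(jumps_at K); case jK: (jumps_at K) => //=.
by rewrite -/(jumps_at K) jK.
Qed.

Lemma jump_timesP k : jump_times (fold_seq h alpha v1) k -> jumps_at k.
Proof.
by rewrite /jump_times /= foldingE -/(jumps_at k); case: ifP.
Qed.

End FoldSequence.

Theorem theorem4p4 (R : realType) (l : nat) (r : R)
    (l_ge2 : (2 <= l)%N) (r_gt0 : 0 < r) (r_lt1 : r < 1) :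
  (max_jumps l r <=
    (2 * pi * 308 ^+ (l - 2) * r ^- (5 * (l - 2) + 1))%:E)%E.
Proof.
apply: ge_ereal_sup => _ [d [h [v1 [w0 [alpha [_ h1 ball_sub w0v1 ->]]]]]].
have h_unit i : dotp (h i) (h i) = 1 by apply: enorm1.
have margin i : r <= dotp w0 (h i).
  apply: ball_in_halfspace => //; first exact: ltW.
  by move=> v /ball_sub; apply.
have near : near_w0 w0 v1.
  rewrite /near_w0 -opprB dotpNl dotpNr opprK -(sqr_sqrtr (dotp_ge0 _)).
  by rewrite -/(enorm _) expr_le1 // sqrtr_ge0.
have [J bJ Jb] := jumps_bound h_unit r_gt0 r_lt1 margin (l - 2).
apply: counting_le (@jump_timesP _ _ _ h alpha v1) _ => K.
apply: le_trans Jb; rewrite ler_nat -size_filter -(size_map alpha).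
have [js _] := jump_wordP h alpha v1 K.
apply: (bJ [set: 'I_l]%SET v1) => //.
- by rewrite cardsT card_ord -addn2 subnK.
- by move=> i _; rewrite finset.in_setT.
Qed.
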